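(* Every mapping $h : X \to K$ into an absorptive, fully continuous semiring $K$ uniquely extends to a fully continuous semiring homomorphism $h : {\mathbb S}^{\infty}[X] \to K$.
   Context: All semirings are commutative and naturally ordered ($a \le b$ iff $a + c = b$ for some $c$). A chain is a totally ordered subset $C$; $\bigsqcup C$ and $\inf C$ denote its supremum and infimum in the natural order. A semiring is fully chain-complete if every chain has a supremum and an infimum, and fully continuous if moreover $a \circ \bigsqcup C = \bigsqcup (a \circ C)$ and $a \circ \inf C = \inf (a \circ C)$ for all $a$, all nonempty chains $C$ and $\circ \in \{+,\cdot\}$. A function is fully continuous if it preserves suprema and infima of nonempty chains. A semiring is absorptive if $a + ab = a$ for all $a,b$. For a finite set $X$, a monomial is a function $m : X \to {\mathbb N}\cup\{\infty\}$ (written as a product $x_1^{m(x_1)}\cdots x_n^{m(x_n)}$); multiplication adds exponents ($x^\infty x^n = x^\infty$); $m_2$ absorbs $m_1$, written $m_2 \succeq m_1$, if $m_2(x) \le m_1(x)$ for all $x$. ${\mathbb S}^{\infty}[X]$ (generalized absorptive polynomials) is the set of (necessarily finite) antichains of monomials w.r.t. $\succeq$, written as formal sums, with polynomial addition and multiplication where only the $\succeq$-maximal monomials are kept and coefficients are disregarded. *)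

(* Defs.v *)
From HB Require Import structures.
From mathcomp Require Import all_boot all_order all_algebra.
From mathcomp Require Import boolp classical_sets.

Set Implicit Arguments.
Unset Strict Implicit.
Unset Printing Implicit Defensive.

Import GRing.Theory.
Local Open Scope classical_set_scope.
Local Open Scope ring_scope.

Section NaturalOrder.
Variable K : comPzSemiRingType.

Definition natle (a b : K) : Prop := exists c, a + c = b.

(* Reflexivity and transitivity of [natle] hold in every semiring. *)
Definition naturally_ordered : Prop :=
  forall a b : K, natle a b -> natle b a -> a = b.

Definition absorptive : Prop := forall a b : K, a + a * b = a.

Definition chain (C : set K) : Prop := total_on C natle.

Definition is_sup (C : set K) (s : K) : Prop :=
  (forall a, C a -> natle a s) /\
  (forall b, (forall a, C a -> natle a b) -> natle s b).

Definition is_inf (C : set K) (i : K) : Prop :=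
  (forall a, C a -> natle i a) /\
  (forall b, (forall a, C a -> natle b a) -> natle b i).

(* The empty chain is included: its supremum is the least element and its
   infimum the greatest one. *)
Definition fully_chain_complete : Prop :=
  forall C : set K, chain C -> (exists s, is_sup C s) /\ (exists i, is_inf C i).

End NaturalOrder.

Definition fully_continuous (K L : comPzSemiRingType) (f : K -> L) : Prop :=
  forall C : set K, chain C -> C !=set0 ->
    (forall s, is_sup C s -> is_sup (f @` C) (f s)) /\
    (forall i, is_inf C i -> is_inf (f @` C) (f i)).

Definition fully_continuous_semiring (K : comPzSemiRingType) : Prop :=
  fully_chain_complete K /\
  forall a : K, fully_continuous (fun b : K => a + b) /\
                fully_continuous (fun b : K => a * b).

(* Exponents: [None] stands for infinity. *)
Definition exponent := option nat.

Definition exp_add (a b : exponent) : exponent :=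
  match a, b with Some m, Some n => Some (m + n)%N | _, _ => None end.

Definition exp_le (a b : exponent) : bool :=
  match a, b with
  | _, None => true
  | None, Some _ => false
  | Some m, Some n => (m <= n)%N
  end.

Section Polynomials.
Variable X : finType.

Definition monomial := X -> exponent.

Definition mon1 : monomial := fun=> Some 0%N.
Definition mon_mul (m1 m2 : monomial) : monomial :=
  fun x => exp_add (m1 x) (m2 x).
Definition mon_var (x : X) : monomial :=
  fun y => Some (if y == x then 1 else 0)%N.

Definition absorbs (m2 m1 : monomial) : Prop :=
  forall x, exp_le (m2 x) (m1 x).

Definition antichain (A : set monomial) : Prop :=
  forall m1 m2, A m1 -> A m2 -> absorbs m2 m1 -> m1 = m2.

Definition maximal (A : set monomial) : set monomial :=
  [set m | A m /\ forall m', A m' -> absorbs m' m -> m' = m].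

(* Finiteness of the antichains is not imposed: it follows from Dickson's
   lemma, as [X] is finite. *)
Record genpoly := GenPoly {
  monos :> set monomial;
  monosP : antichain monos
}.

Lemma maximal_antichain (A : set monomial) : antichain (maximal A).
Proof. by move=> m1 m2 [A1 max1] [A2 _] /(max1 _ A2). Qed.

Lemma set0_antichain : antichain set0.
Proof. by []. Qed.

Lemma set1_antichain (m : monomial) : antichain [set m].
Proof. by move=> m1 m2 -> ->. Qed.

Definition poly0 : genpoly := GenPoly set0_antichain.
Definition poly_mon (m : monomial) : genpoly := GenPoly (@set1_antichain m).
Definition poly1 : genpoly := poly_mon mon1.
Definition poly_var (x : X) : genpoly := poly_mon (mon_var x).
Definition poly_add (p q : genpoly) : genpoly :=
  GenPoly (@maximal_antichain (p `|` q)).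
Definition poly_mul (p q : genpoly) : genpoly :=
  GenPoly (@maximal_antichain [set mon_mul a b | a in p & b in q]).

Lemma exp_le_refl a : exp_le a a.
Proof. by case: a => /=. Qed.

Lemma exp_le_trans b a c : exp_le a b -> exp_le b c -> exp_le a c.
Proof. by case: a b c => [a|] [b|] [c|] //=; apply: leq_trans. Qed.

Lemma exp_le_anti a b : exp_le a b -> exp_le b a -> a = b.
Proof.
by case: a b => [a|] [b|] //= ab ba; congr Some; apply/anti_leq/andP.
Qed.

Lemma exp_le_add a b c d :
  exp_le a b -> exp_le c d -> exp_le (exp_add a c) (exp_add b d).
Proof. by case: a b c d => [a|] [b|] [c|] [d|] //=; apply: leq_add. Qed.

Lemma absorbs_refl m : absorbs m m.
Proof. by move=> x; apply: exp_le_refl. Qed.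

Lemma absorbs_trans m2 m1 m3 : absorbs m1 m2 -> absorbs m2 m3 -> absorbs m1 m3.
Proof. by move=> h1 h2 x; apply: exp_le_trans (h1 x) (h2 x). Qed.

Lemma absorbs_anti m1 m2 : absorbs m1 m2 -> absorbs m2 m1 -> m1 = m2.
Proof. by move=> h1 h2; apply/funext => x; apply: exp_le_anti. Qed.

Lemma absorbs_mul m1 m2 m3 m4 : absorbs m1 m2 -> absorbs m3 m4 ->
  absorbs (mon_mul m1 m3) (mon_mul m2 m4).
Proof. by move=> h1 h2 x; apply: exp_le_add. Qed.

Lemma mon_mulC : commutative mon_mul.
Proof.
move=> a b; apply/funext => x; rewrite /mon_mul.
by case: (a x) (b x) => [m|] [n|] //=; rewrite addnC.
Qed.

Lemma mon_mulA : associative mon_mul.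
Proof.
move=> a b c; apply/funext => x; rewrite /mon_mul.
by case: (a x) (b x) (c x) => [m|] [n|] [k|] //=; rewrite addnA.
Qed.

Lemma mon_mul1m : left_id mon1 mon_mul.
Proof. by move=> a; apply/funext => x; rewrite /mon_mul /=; case: (a x). Qed.

Let ninf (m : monomial) := (\sum_(x : X) (m x == None))%N.
Let fsum (m : monomial) := (\sum_(x : X) odflt 0 (m x))%N.

Let sum_lt (f g : X -> nat) x0 : (forall x, f x <= g x)%N ->
  (f x0 < g x0)%N -> (\sum_x f x < \sum_x g x)%N.
Proof.
move=> fg lt0; rewrite (bigD1 x0) //= [ltnRHS](bigD1 x0) //= -addSn.
by apply: leq_add => //; apply: leq_sum.
Qed.

Let absorbs_lt m' m : absorbs m' m -> m' <> m ->
  (ninf m' < ninf m)%N \/ (ninf m' <= ninf m)%N /\ (fsum m' < fsum m)%N.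
Proof.
move=> le ne.
have leI x : ((m' x == None) <= (m x == None))%N.
  by move: (le x); case: (m' x) (m x) => [a|] [b|].
have [[x x1 x2]|noI] := pselect (exists2 x, m x = None & m' x <> None).
  left; apply: (sum_lt (x0 := x)) => //.
  by rewrite x1 eqxx; move: x2; case: (m' x).
have noI' x : m x = None -> m' x = None.
  by move=> mx; apply: contrapT => m'x; apply: noI; exists x.
right; split; first by apply: leq_sum => x _; apply: leI.
have lef x : (odflt 0 (m' x) <= odflt 0 (m x))%N.
  move: (le x) (noI' x); case: (m x) (m' x) => [a|] [b|] //= _ h.
  by have := h erefl.
have [x nex] : exists x, m' x <> m x.
  apply: contrapT => /forallNP h; apply: ne; apply/funext => x.
  by apply: contrapT (h x).
apply: (sum_lt (x0 := x)) => //.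
move: (le x) nex (noI' x); case: (m x) (m' x) => [a|] [b|] //=.
  by rewrite leq_eqVlt => /orP[/eqP->|].
by move=> _ _ h; have := h erefl.
Qed.

Lemma maximal_exists (A : set monomial) m : A m ->
  exists2 m', maximal A m' & absorbs m' m.
Proof.
have [n] := ubnP (ninf m); elim: n m => // n IHn m.
have [k] := ubnP (fsum m); elim: k m => // k IHk m ltk ltn Am.
have [mm|nmm] := pselect (maximal A m); first by exists m => //; apply: absorbs_refl.
have [m' [Am' le ne]] : exists m', [/\ A m', absorbs m' m & m' <> m].
  apply: contrapT => no; apply: nmm; split=> // m' Am' le.
  by apply: contrapT => ne; apply: no; exists m'.
suff [m'' mx le''] : exists2 m'', maximal A m'' & absorbs m'' m'.
  by exists m'' => //; apply: absorbs_trans le.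
have [lt1|[le1 lt2]] := absorbs_lt le ne.
  by apply: IHn => //; apply: leq_trans lt1 _.
by apply: IHk => //; [apply: leq_trans lt2 _ | apply: leq_ltn_trans le1 _].
Qed.

(* An antichain is determined by the set of monomials that it absorbs. *)
Definition absorbed (A : set monomial) : set monomial :=
  [set m | exists2 a, A a & absorbs a m].

Lemma absorbed_maximal A : absorbed (maximal A) = absorbed A.
Proof.
apply/seteqP; split=> m [a]; first by case=> Aa _ le; exists a.
by move=> /maximal_exists[b mb ba] am; exists b => //; apply: absorbs_trans am.
Qed.

Lemma genpoly_eq (p q : genpoly) : monos p = monos q -> p = q.
Proof.
case: p q => [A hA] [B hB] /= e; case: B / e hB => hB.
by congr GenPoly; apply: Prop_irrelevance.
Qed.

Lemma absorbed_inj (p q : genpoly) : absorbed p = absorbed q -> p = q.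
Proof.
suff sub (r s : genpoly) : absorbed r = absorbed s -> monos r `<=` monos s.
  by move=> e; apply/genpoly_eq/seteqP; split; apply: sub.
move=> e a ra.
have [b sb ba] : absorbed s a by rewrite -e; exists a => //; apply: absorbs_refl.
have [c rc cb] : absorbed r b by rewrite e; exists b => //; apply: absorbs_refl.
have ac := monosP ra rc (absorbs_trans cb ba).
by rewrite (_ : a = b) //; apply: absorbs_anti => //; rewrite ac.
Qed.

Lemma absorbed_add p q : absorbed (poly_add p q) = absorbed p `|` absorbed q.
Proof.
rewrite /= absorbed_maximal; apply/seteqP; split=> m.
  by case=> a [pa|qa] am; [left|right]; exists a.
by case=> [] [a ha am]; exists a => //; [left|right].
Qed.

Lemma absorbed_mul p q m : absorbed (poly_mul p q) m <->
  exists a b, [/\ absorbed p a, absorbed q b & absorbs (mon_mul a b) m].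
Proof.
rewrite /= absorbed_maximal; split.
  case=> _ [a pa [b qb <-]] am; exists a, b.
  by split=> //; [exists a | exists b] => //; apply: absorbs_refl.
case=> a [b [[a' pa aa] [b' qb bb] am]].
exists (mon_mul a' b'); first by exists a' => //; exists b'.
by apply: absorbs_trans am; apply: absorbs_mul.
Qed.

Lemma poly_addC : commutative poly_add.
Proof. by move=> p q; apply: absorbed_inj; rewrite !absorbed_add setUC. Qed.

Lemma poly_addA : associative poly_add.
Proof. by move=> p q r; apply: absorbed_inj; rewrite !absorbed_add setUA. Qed.

Lemma poly_add0p : left_id poly0 poly_add.
Proof.
move=> p; apply: absorbed_inj; rewrite absorbed_add.
by apply/seteqP; split=> m; [case=> // -[] | right].
Qed.

Lemma poly_mulC : commutative poly_mul.
Proof.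
suff sub p q : absorbed (poly_mul p q) `<=` absorbed (poly_mul q p).
  by move=> p q; apply: absorbed_inj; apply/seteqP; split; apply: sub.
move=> m /absorbed_mul[a [b [pa qb ab]]]; apply/absorbed_mul; exists b, a.
by split=> //; rewrite mon_mulC.
Qed.

Lemma poly_mulA : associative poly_mul.
Proof.
move=> p q r; apply: absorbed_inj; apply/seteqP; split=> m.
  case/absorbed_mul=> a [b [pa /absorbed_mul[c [d [qc rd cd]]] ab]].
  apply/absorbed_mul; exists (mon_mul a c), d; split=> //.
    by apply/absorbed_mul; exists a, c; split=> //; apply: absorbs_refl.
  rewrite -mon_mulA; apply: absorbs_trans ab.
  by apply: absorbs_mul => //; apply: absorbs_refl.
case/absorbed_mul=> a [b [/absorbed_mul[c [d [pc qd cd]]] rb ab]].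
apply/absorbed_mul; exists c, (mon_mul d b); split=> //.
  by apply/absorbed_mul; exists d, b; split=> //; apply: absorbs_refl.
rewrite mon_mulA; apply: absorbs_trans ab.
by apply: absorbs_mul => //; apply: absorbs_refl.
Qed.

Lemma poly_mul1p : left_id poly1 poly_mul.
Proof.
move=> p; apply: absorbed_inj; apply/seteqP; split=> m.
  case/absorbed_mul=> a [b [[_ -> _] [c pc cb] ab]]; exists c => //.
  apply: absorbs_trans ab; rewrite -[c]mon_mul1m.
  by apply: absorbs_mul => // x; case: (a x).
move=> pm; apply/absorbed_mul; exists mon1, m; split=> //.
  by exists mon1 => //; apply: absorbs_refl.
by rewrite mon_mul1m; apply: absorbs_refl.
Qed.

Lemma poly_mul0p : left_zero poly0 poly_mul.
Proof.
move=> p; apply: absorbed_inj; apply/seteqP; split=> m; last by case.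
by case/absorbed_mul=> a [b [[]]].
Qed.

Lemma poly_mulDl : left_distributive poly_mul poly_add.
Proof.
move=> p q r; apply: absorbed_inj; rewrite absorbed_add.
apply/seteqP; split=> m.
  case/absorbed_mul=> a [b []]; rewrite absorbed_add => -[pa|qa] rb ab.
    by left; apply/absorbed_mul; exists a, b.
  by right; apply/absorbed_mul; exists a, b.
case=> /absorbed_mul[a [b [ha rb ab]]]; apply/absorbed_mul; exists a, b.
  by split=> //; rewrite absorbed_add; left.
by split=> //; rewrite absorbed_add; right.
Qed.

HB.instance Definition _ := gen_eqMixin genpoly.
HB.instance Definition _ := gen_choiceMixin genpoly.
HB.instance Definition _ :=
  GRing.isNmodule.Build genpoly poly_addA poly_addC poly_add0p.
HB.instance Definition _ := GRing.Nmodule_isComPzSemiRing.Build genpoly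
  poly_mulA poly_mulC poly_mul1p poly_mulDl poly_mul0p.

Lemma genpoly_absorptive : absorptive genpoly.
Proof.
move=> p q; apply: absorbed_inj; rewrite absorbed_add.
apply/seteqP; split=> m; last by left.
case=> // /absorbed_mul[a [b [[c pc ca] _ abm]]]; exists c => //.
apply: absorbs_trans abm; apply: absorbs_trans ca _ => x.
by rewrite /mon_mul; case: (a x) (b x) => [k|] [l|] //=; apply: leq_addr.
Qed.

Lemma genpoly_natle (p q : genpoly) :
  natle p q <-> absorbed p `<=` absorbed q.
Proof.
split=> [[r <-]|pq]; first by rewrite absorbed_add; left.
by exists q; apply: absorbed_inj; rewrite absorbed_add; apply/setUidPr.
Qed.

Lemma genpoly_naturally_ordered : naturally_ordered genpoly.
Proof.
by move=> p q /genpoly_natle pq /genpoly_natle qp; apply/absorbed_inj/seteqP.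
Qed.

End Polynomials.

Arguments poly_var {X} x.

(* Main.v *)
(* The value of a monomial is forced: a power [x^oo] is the infimum of the
   chain of the [x^n], so it must go to the infimum of the [(h x)^n]; these
   values are multiplicative by continuity of the product.  By Dickson's lemma a
   polynomial is a finite sum of monomials, so its value is forced too, and it
   is the least upper bound of the values of the monomials that it absorbs.
   This makes the semiring laws and the suprema immediate.  For the infimum [i]
   of a chain, a compactness argument shows that for each [N] some member of the
   chain is below the polynomial obtained from [i] by replacing the exponent
   infinity with [N]; the values of these polynomials decrease to that of [i]
   as [N] grows. *)
Require Import Defs.
From mathcomp Require Import all_boot all_order all_algebra.
From mathcomp Require Import boolp classical_sets.
From HB Require Import structures.

Set Implicit Arguments.
Unset Strict Implicit.
Unset Printing Implicit Defensive.

Import GRing.Theory.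
Local Open Scope classical_set_scope.
Local Open Scope ring_scope.

(** * The natural order, chains and infima of decreasing sequences *)

Section NaturalOrderTheory.
Variable K : comPzSemiRingType.
Implicit Types a b c d : K.

Lemma natle_refl a : natle a a.
Proof. by exists 0; rewrite addr0. Qed.

Lemma natle_trans b a c : natle a b -> natle b c -> natle a c.
Proof. by move=> [d <-] [e <-]; exists (d + e); rewrite addrA. Qed.

Lemma natle0 a : natle 0 a.
Proof. by exists a; rewrite add0r. Qed.

Lemma natle_addl a b : natle a (a + b).
Proof. by exists b. Qed.

Lemma natle_addr a b : natle b (a + b).
Proof. by rewrite addrC; apply: natle_addl. Qed.

Lemma natle_add a b c d : natle a b -> natle c d -> natle (a + c) (b + d).
Proof. by move=> [e <-] [e' <-]; exists (e + e'); rewrite addrACA. Qed.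

Lemma natle_mul2l a b c : natle a b -> natle (c * a) (c * b).
Proof. by move=> [e <-]; rewrite mulrDr; apply: natle_addl. Qed.

Lemma natle_mul a b c d : natle a b -> natle c d -> natle (a * c) (b * d).
Proof.
move=> ab cd; apply: (natle_trans (natle_mul2l a cd)).
by rewrite ![_ * d]mulrC; apply: natle_mul2l.
Qed.

(** Induction on [s], keeping the smaller of the bound so far and the new member. Compactness
    arguments use it on finite families. *)
Lemma natle_chain_min (C : set K) (I : eqType) (s : seq I) (q : I -> K) :
    chain C -> C !=set0 -> (forall i, C (q i)) ->
  exists2 p, C p & forall i, i \in s -> natle p (q i).
Proof.
move=> chC [p0 Cp0] Cq; elim: s => [|i s [p Cp ple]]; first by exists p0.
have [lepq|leqp] := chC _ _ Cp (Cq i).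
  by exists p => // j /predU1P[->|/ple].
exists (q i) => // j /predU1P[->|/ple]; first exact: natle_refl.
exact: natle_trans.
Qed.

Lemma is_inf_unique (K_ordered : naturally_ordered K) (C : set K) a b :
  is_inf C a -> is_inf C b -> a = b.
Proof. by move=> [la ga] [lb gb]; apply: K_ordered; [apply: gb|apply: ga]. Qed.

Definition decreasing_to (u : nat -> K) (l : K) : Prop :=
  (forall m n, (m <= n)%N -> natle (u n) (u m)) /\ is_inf (range u) l.

Lemma decreasing_to_cst a : decreasing_to (fun=> a) a.
Proof.
split=> [*|]; first exact: natle_refl.
by split=> [_ [_ _ <-]|b]; [apply: natle_refl|apply; exists 0%N].
Qed.

Lemma decreasing_to_chain u l : decreasing_to u l -> chain (range u).
Proof.
move=> [dec _] _ _ [m _ <-] [n _ <-].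
by case/orP: (leq_total m n) => /dec; [right|left].
Qed.

(** A cofinal subsequence of a decreasing sequence has the same lower bounds. *)
Lemma decreasing_to_comp u l (phi : nat -> nat) :
    (forall m n, (m <= n)%N -> (phi m <= phi n)%N) ->
    (forall n, (n <= phi n)%N) ->
  decreasing_to u l -> decreasing_to (u \o phi) l.
Proof.
move=> phi_mono phi_ge [dec [lb glb]]; split=> [m n mn|].
  exact/dec/phi_mono.
split=> [_ [n _ <-]|b ble]; first by apply: lb; exists (phi n).
apply: glb => _ [n _ <-]; apply: natle_trans (dec _ _ (phi_ge n)).
by apply: ble; exists n.
Qed.

(* By continuity one argument at a time, [op l k] is the infimum of the doubly
   indexed family [op (u n) (v m)], in which the diagonal is cofinal. *)
Lemma decreasing_to_op (op : K -> K -> K) (opC : commutative op)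
    (op_mono : forall a b c, natle a b -> natle (op c a) (op c b))
    (op_cont : forall a, fully_continuous (op a)) u l v k :
  decreasing_to u l -> decreasing_to v k ->
  decreasing_to (fun n => op (u n) (v n)) (op l k).
Proof.
have op_mono2 a b c d : natle a b -> natle c d -> natle (op a c) (op b d).
  move=> ab cd; apply: (natle_trans (op_mono _ _ a cd)).
  by rewrite ![op _ d]opC; apply: op_mono.
move=> ul vk; have [decu [lbu glbu]] := ul; have [decv [lbv glbv]] := vk.
split=> [m n mn|]; first by apply: op_mono2; [apply: decu|apply: decv].
split=> [_ [n _ <-]|b ble].
  by apply: op_mono2; [apply: lbu|apply: lbv]; exists n.
have ble2 n m : natle b (op (u n) (v m)).
  apply: (@natle_trans (op (u (maxn n m)) (v (maxn n m)))).
    by apply: ble; exists (maxn n m).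
  by apply: op_mono2;
    [apply: decu; apply: leq_maxl|apply: decv; apply: leq_maxr].
have range0 (w : nat -> K) : range w !=set0 by exists (w 0%N); exists 0%N.
have [_ /(_ _ ul.2)[_]] := op_cont k _ (decreasing_to_chain ul) (range0 u).
rewrite [op l k]opC; apply => _ [_ [n _ <-] <-].
have [_ /(_ _ vk.2)[_]] := op_cont (u n) _ (decreasing_to_chain vk) (range0 v).
by rewrite [op k _]opC; apply => _ [_ [m _ <-] <-].
Qed.

End NaturalOrderTheory.

(** * Absorptive semirings: addition is the join *)

Section AbsorptiveTheory.
Variable K : comPzSemiRingType.
Hypothesis K_absorptive : absorptive K.
Implicit Types a b c : K.

Lemma absorptive_addrr a : a + a = a.
Proof. by have := K_absorptive a 1; rewrite mulr1. Qed.

Lemma absorptive_natleM a b : natle (a * b) a.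
Proof. by exists a; rewrite addrC K_absorptive. Qed.

Lemma absorptive_add_lub a b c : natle (a + b) c <-> natle a c /\ natle b c.
Proof.
split=> [le|[ac bc]]; last by rewrite -[c]absorptive_addrr; apply: natle_add.
by split; apply: natle_trans le; [apply: natle_addl|apply: natle_addr].
Qed.

Lemma absorptive_sum_lub (I : eqType) (s : seq I) (F : I -> K) c :
  natle (\sum_(i <- s) F i) c <-> (forall i, i \in s -> natle (F i) c).
Proof.
elim: s => [|i s IHs]; first by rewrite big_nil; split=> // _; apply: natle0.
rewrite big_cons absorptive_add_lub IHs; split=> [[ic sc] j|le].
  by case/predU1P=> [->|/sc].
by split=> [|j js]; apply: le; rewrite inE ?eqxx ?js ?orbT.
Qed.

End AbsorptiveTheory.

(** * Powers with possibly infinite exponents *)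

Section ExponentPowers.
Variable K : comPzSemiRingType.

Definition exp_trunc (N : nat) (e : exponent) : exponent := Some (odflt N e).

(** In an absorptive, chain-complete semiring the powers form a chain, so [xget] does select an
    infimum. *)
Definition exp_pow (a : K) (e : exponent) : K :=
  match e with
  | Some n => a ^+ n
  | None => xget 0 (is_inf (range (fun n => a ^+ n)))
  end.

Hypothesis K_ordered : naturally_ordered K.
Hypothesis K_absorptive : absorptive K.
Hypothesis K_continuous : fully_continuous_semiring K.

Lemma decreasing_to_add (u v : nat -> K) l k :
  decreasing_to u l -> decreasing_to v k ->
  decreasing_to (fun n => u n + v n) (l + k).
Proof.
apply: (decreasing_to_op (@addrC K)) => [a b c ab|a].
  by apply: natle_add => //; apply: natle_refl.
exact: (K_continuous.2 a).1.
Qed.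

Lemma decreasing_to_mul (u v : nat -> K) l k :
  decreasing_to u l -> decreasing_to v k ->
  decreasing_to (fun n => u n * v n) (l * k).
Proof.
apply: (decreasing_to_op (@mulrC K)) => [a b c|a]; first exact: natle_mul2l.
exact: (K_continuous.2 a).2.
Qed.

Lemma natle_exp (a : K) m n : (m <= n)%N -> natle (a ^+ n) (a ^+ m).
Proof. by move=> mn; rewrite -(subnKC mn) exprD; apply: absorptive_natleM. Qed.

Lemma exp_decreasing_to (a : K) :
  decreasing_to (fun n => a ^+ n) (exp_pow a None).
Proof.
split; first exact: natle_exp.
apply: (@xgetPex _ _ (is_inf _)).
suff: chain (range (fun n => a ^+ n)) by case/K_continuous.1.
move=> _ _ [m _ <-] [n _ <-].
by case/orP: (leq_total m n) => /(natle_exp a); [right|left].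
Qed.

Lemma exp_pow_decreasing_to (a : K) e :
  decreasing_to (fun N => exp_pow a (exp_trunc N e)) (exp_pow a e).
Proof.
by case: e => [n|] /=; [apply: decreasing_to_cst|apply: exp_decreasing_to].
Qed.

Lemma exp_pow_add (a : K) e1 e2 :
  exp_pow a (exp_add e1 e2) = exp_pow a e1 * exp_pow a e2.
Proof.
have := decreasing_to_mul (exp_pow_decreasing_to a e1)
  (exp_pow_decreasing_to a e2).
have -> : (fun N => exp_pow a (exp_trunc N e1) * exp_pow a (exp_trunc N e2)) =
    (fun N => a ^+ (odflt N e1 + odflt N e2)).
  by apply/funext => N; rewrite /= exprD.
case=> _ lim; apply: (is_inf_unique K_ordered) lim.
(* The product of truncated powers has exponent [m + n], [m + N], [N + n] or [N + N]: a constant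
   sequence, or a cofinal subsequence of the powers of [a]. *)
case: e1 e2 => [m|] [n|]; first exact: (decreasing_to_cst (a ^+ (m + n))).2.
- apply: (decreasing_to_comp (phi := addn m) _ _ (exp_decreasing_to a)).2.
    by move=> i j; rewrite leq_add2l.
  by move=> i; apply: leq_addl.
- apply: (decreasing_to_comp (phi := addn^~ n) _ _ (exp_decreasing_to a)).2.
    by move=> i j; rewrite leq_add2r.
  by move=> i; apply: leq_addr.
- apply: (decreasing_to_comp (phi := fun i => i + i)%N _ _
    (exp_decreasing_to a)).2.
    by move=> i j ij; apply: leq_add.
  by move=> i; apply: leq_addr.
Qed.

Lemma exp_pow_le (a : K) e1 e2 :
  exp_le e1 e2 -> natle (exp_pow a e2) (exp_pow a e1).
Proof.
case: e1 e2 => [m|] [n|] //; first exact: natle_exp; last first.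
  by move=> _; apply: natle_refl.
by move=> _; apply: (exp_decreasing_to a).2.1; exists m.
Qed.

End ExponentPowers.

Fact exp_addA : associative exp_add.
Proof. by move=> [m|] [n|] [k|] //=; rewrite addnA. Qed.

Fact exp_addC : commutative exp_add.
Proof. by move=> [m|] [n|] //=; rewrite addnC. Qed.

Fact exp_add0e : left_id (Some 0%N) exp_add.
Proof. by case. Qed.

(** Makes big operators available for the exponent of one variable in a product of monomials. *)
HB.instance Definition _ := Monoid.isComLaw.Build exponent (Some 0%N) exp_add
  exp_addA exp_addC exp_add0e.

(** * Dickson's lemma and finiteness of antichains *)

Section Dickson.
Variable X : finType.
Implicit Types (A : set (monomial X)) (s : seq (monomial X)).

Lemma bounded_exponents s (x : X) :
  exists M, forall m k, m \in s -> m x = Some k -> (k <= M)%N.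
Proof.
exists (\sum_(m <- s) odflt 0 (m x))%N => m k ms mx.
by rewrite (big_rem m) //= mx leq_addr.
Qed.

(* Dickson's lemma, by induction on the list of the variables compared: a basis
   of [A] for the remaining variables serves every monomial whose exponent of
   [x] exceeds the finite exponents of [x] in that basis, and each of the other
   values of that exponent is treated separately. *)
Lemma dickson (xs : seq X) A :
  exists2 s : seq (monomial X), (forall b, b \in s -> A b) &
  forall a, A a ->
    exists2 b, b \in s & forall x, x \in xs -> exp_le (b x) (a x).
Proof.
elim: xs A => [|x xs IHxs] A.
  have [[a Aa]|noA] := pselect (exists a, A a); last first.
    by exists [::] => // a Aa; case: noA; exists a.
  exists [:: a] => [b|b _]; first by rewrite inE => /eqP ->.
  by exists a; rewrite ?inE ?eqxx.
have [s1 s1A s1P] := IHxs (A `&` [set a | a x != None]).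
have [M M_ge] := bounded_exponents s1 x.
have /choice[s sP] e : exists s : seq (monomial X),
    (forall b, b \in s -> A b /\ b x = e) /\
    (forall a, A a -> a x = e ->
      exists2 b, b \in s & forall y, y \in xs -> exp_le (b y) (a y)).
  have [s sA sP] := IHxs (A `&` [set a | a x = e]).
  by exists s; split=> // a Aa ax; apply: sP.
(* Of the bases [s e], only those for infinity and for [0] to [M] are kept; a finite exponent above
   [M] is served by [s1]. *)
pose es := None :: map Some (iota 0 M.+1).
exists (s1 ++ flatten (map s es)) => [b|a Aa].
  rewrite mem_cat => /orP[/s1A[]//|/flatten_mapP[e _]].
  by have [+ _] := sP e => /[apply] -[].
have [ax|] := boolP (a x \in es).
  have [sA /(_ a Aa erefl)[b bs ba]] := sP (a x).
  exists b => [|y /predU1P[->|/ba//]].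
    by rewrite mem_cat; apply/orP; right; apply/flatten_mapP; exists (a x).
  by rewrite (sA b bs).2 exp_le_refl.
case ax: (a x) => [n|]; last by rewrite inE.
rewrite in_cons -[_ == None]/false orFb mem_map; last by move=> ? ? [].
rewrite mem_iota /= add0n -ltnNge ltnS => Mn.
have [|b bs1 ba] := s1P a; first by split=> //=; rewrite ax.
exists b; first by rewrite mem_cat bs1.
move=> y /predU1P[->|/ba//]; have [_ /=] := s1A b bs1.
case bx: (b x) => [k|//] _; rewrite ax /=.
by apply: leq_trans (ltnW Mn); apply: M_ge bx.
Qed.

(** Each monomial of [p] is absorbed by a member of the Dickson basis, which also lies in the
    antichain [p], so the two coincide. *)
Lemma genpoly_finite (p : genpoly X) :
  exists s : seq (monomial X), forall m, m \in s <-> monos p m.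
Proof.
have [s sp sP] := dickson (enum X) p.
exists s => m; split=> [/sp//|pm]; have [b bs bm] := sP m pm.
rewrite (monosP pm (sp b bs)) // => x.
by apply: bm; rewrite mem_enum.
Qed.

Definition support (p : genpoly X) : seq (monomial X) :=
  sval (cid (genpoly_finite p)).

Lemma supportP (p : genpoly X) m : m \in support p <-> monos p m.
Proof. by rewrite /support; case: cid => s /= ->. Qed.

End Dickson.

(** * Polynomials as sums of products of powers of variables *)

Section GeneralizedPolynomials.
Variable X : finType.
Implicit Types (m : monomial X) (p q : genpoly X).

Lemma monos_absorbed p m : monos p m -> absorbed p m.
Proof. by exists m => //; apply: absorbs_refl. Qed.

Lemma absorbedW (A : set (monomial X)) m1 m2 :
  absorbed A m1 -> absorbs m1 m2 -> absorbed A m2.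
Proof. by case=> a Aa am1 m12; exists a => //; apply: absorbs_trans m12. Qed.

Lemma poly_mon_le m p : natle (poly_mon m) p <-> absorbed p m.
Proof.
rewrite genpoly_natle; split=> [|pm m' [_ ->]]; last exact: absorbedW.
by apply; apply: monos_absorbed.
Qed.

Lemma poly_mon1 : poly_mon (@mon1 X) = 1.
Proof. by []. Qed.

Lemma poly_monM m1 m2 :
  poly_mon (mon_mul m1 m2) = poly_mon m1 * poly_mon m2.
Proof.
apply: absorbed_inj; rewrite [RHS]absorbed_maximal; congr absorbed.
apply/seteqP; split=> [m -> /=|_ [_ -> [_ -> <-]] //].
by exists m1 => //; exists m2.
Qed.

Lemma poly_sum_mon p : p = \sum_(m <- support p) poly_mon m.
Proof.
apply: (@genpoly_naturally_ordered X).
  apply/genpoly_natle => m [a pa am]; apply/poly_mon_le.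
  apply: (@natle_trans _ (poly_mon a)).
    by apply/poly_mon_le; exists a.
  move: (natle_refl (\sum_(m <- support p) poly_mon m)).
  move/(absorptive_sum_lub (@genpoly_absorptive X))/(_ a); apply.
  exact/supportP.
apply/(absorptive_sum_lub (@genpoly_absorptive X)) => m /supportP pm.
exact/poly_mon_le/monos_absorbed.
Qed.

Definition mon_pow (x : X) (e : exponent) : monomial X :=
  fun y => if y == x then e else Some 0%N.

Lemma mon_powD x e1 e2 :
  mon_pow x (exp_add e1 e2) = mon_mul (mon_pow x e1) (mon_pow x e2).
Proof. by apply/funext => y; rewrite /mon_pow /mon_mul; case: eqP. Qed.

Lemma poly_varX x n : poly_var x ^+ n = poly_mon (mon_pow x (Some n)).
Proof.
elim: n => [|n IHn].
  rewrite expr0 -poly_mon1; congr poly_mon.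
  by apply/funext => y; rewrite /mon_pow if_same.
rewrite exprS IHn -poly_monM; congr poly_mon.
rewrite -[Some n.+1]/(exp_add (Some 1%N) (Some n)) mon_powD; congr mon_mul.
by apply/funext => y; rewrite /mon_var /mon_pow; case: eqP.
Qed.

Lemma poly_var_inf x :
  is_inf (range (fun n => poly_var x ^+ n)) (poly_mon (mon_pow x None)).
Proof.
split=> [_ [n _ <-]|p ple].
  rewrite poly_varX; apply/poly_mon_le; exists (mon_pow x (Some n)) => //.
  by move=> y; rewrite /mon_pow; case: eqP.
apply/genpoly_natle => m pm; exists (mon_pow x None) => // y.
rewrite /mon_pow; case: eqP => [->|_]; last by case: (m y).
case mx: (m x) => [k|//].
(* If [x] had a finite exponent [k] in [m], the bound by the power [k.+1] would give [k.+1 <= k]. *)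
have /genpoly_natle/(_ m pm) : natle p (poly_var x ^+ k.+1).
  by apply: ple; exists k.+1.
rewrite poly_varX => -[_ -> /(_ x)]; rewrite /mon_pow eqxx mx /=.
by rewrite ltnn.
Qed.

Lemma monomial_prod m :
  m = \big[@mon_mul X/@mon1 X]_(x : X) mon_pow x (m x).
Proof.
apply/funext => y.
have evalM : {morph (fun m : monomial X => m y) :
    a b / mon_mul a b >-> exp_add a b} by [].
rewrite (big_morph _ evalM (erefl (Some 0%N))) (bigD1 y) //= big1 => [|x xy].
  by rewrite /mon_pow eqxx; case: (m y) => //= k; rewrite addn0.
by rewrite /mon_pow eq_sym (negPf xy).
Qed.

Lemma poly_mon_prod m :
  poly_mon m = \prod_(x : X) poly_mon (mon_pow x (m x)).
Proof.
by rewrite {1}[m]monomial_prod (big_morph _ poly_monM poly_mon1).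
Qed.

End GeneralizedPolynomials.

(** * The evaluation homomorphism, its continuity and uniqueness *)

Section Evaluation.
Variables (X : finType) (K : comPzSemiRingType).
Hypothesis K_ordered : naturally_ordered K.
Hypothesis K_absorptive : absorptive K.
Hypothesis K_continuous : fully_continuous_semiring K.
Variable h : X -> K.
Implicit Types (m : monomial X) (p q : genpoly X).

Definition mon_eval m : K := \prod_(x : X) exp_pow (h x) (m x).

Definition genpoly_eval p : K := \sum_(m <- support p) mon_eval m.

Lemma mon_eval_le m1 m2 :
  absorbs m2 m1 -> natle (mon_eval m1) (mon_eval m2).
Proof.
move=> le; apply: (big_ind2 (@natle K)) => [||x _]; first exact: natle_refl.
  by move=> a b c d; apply: natle_mul.
exact: exp_pow_le.
Qed.

Lemma mon_evalM m1 m2 :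
  mon_eval (mon_mul m1 m2) = mon_eval m1 * mon_eval m2.
Proof.
rewrite /mon_eval -big_split /=.
by apply: eq_bigr => x _; apply: exp_pow_add.
Qed.

(** Absorbed monomials have smaller values, so they add no new condition. This universal property
    replaces computations with the maximal monomials of sums and products. *)
Lemma genpoly_eval_lub p b : natle (genpoly_eval p) b <->
  forall m, absorbed p m -> natle (mon_eval m) b.
Proof.
rewrite absorptive_sum_lub //; split=> le m.
  by case=> a /supportP/le ab /mon_eval_le; move/natle_trans; apply.
by move=> /supportP pm; apply/le/monos_absorbed.
Qed.

Lemma mon_eval_le_genpoly p m :
  absorbed p m -> natle (mon_eval m) (genpoly_eval p).
Proof. exact: (genpoly_eval_lub p _).1 (natle_refl _) m. Qed.

Lemma genpoly_eval_le p q :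
  natle p q -> natle (genpoly_eval p) (genpoly_eval q).
Proof.
move=> /genpoly_natle pq; apply/genpoly_eval_lub => m /pq.
exact: mon_eval_le_genpoly.
Qed.

Lemma genpoly_eval_mon m : genpoly_eval (poly_mon m) = mon_eval m.
Proof.
apply: K_ordered; last exact/mon_eval_le_genpoly/monos_absorbed.
by apply/genpoly_eval_lub => m' [_ -> /mon_eval_le].
Qed.

Lemma genpoly_eval_var x : genpoly_eval (poly_var x) = h x.
Proof.
rewrite genpoly_eval_mon /mon_eval (bigD1 x) //= big1 => [|y yx].
  by rewrite /mon_var eqxx mulr1 /= expr1.
by rewrite /mon_var (negPf yx).
Qed.

Lemma genpoly_eval0 : genpoly_eval 0 = 0.
Proof.
apply: K_ordered; last exact: natle0.
by apply/genpoly_eval_lub => m [].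
Qed.

Lemma genpoly_evalD p q :
  genpoly_eval (p + q) = genpoly_eval p + genpoly_eval q.
Proof.
apply: K_ordered; last first.
  by apply/absorptive_add_lub => //; split; apply: genpoly_eval_le;
    [apply: natle_addl|apply: natle_addr].
apply/genpoly_eval_lub => m; rewrite absorbed_add.
by case=> /mon_eval_le_genpoly le; apply: (natle_trans le);
  [apply: natle_addl|apply: natle_addr].
Qed.

Lemma genpoly_eval1 : genpoly_eval 1 = 1.
Proof.
by rewrite -[1](@poly_mon1 X) genpoly_eval_mon /mon_eval big1.
Qed.

Lemma genpoly_evalM p q :
  genpoly_eval (p * q) = genpoly_eval p * genpoly_eval q.
Proof.
apply: K_ordered.
  apply/genpoly_eval_lub => m /absorbed_mul[a [b [pa qb /mon_eval_le abm]]].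
  apply: (natle_trans abm); rewrite mon_evalM.
  by apply: natle_mul; apply: mon_eval_le_genpoly.
rewrite {1 2}/genpoly_eval big_distrlr /=.
apply/absorptive_sum_lub => // a /supportP pa.
apply/absorptive_sum_lub => // b /supportP qb.
rewrite -mon_evalM; apply: mon_eval_le_genpoly; apply/absorbed_mul.
exists a, b; split; [exact: monos_absorbed..|exact: absorbs_refl].
Qed.

Lemma genpoly_eval_sup (C : set (genpoly X)) s :
  is_sup C s -> is_sup (genpoly_eval @` C) (genpoly_eval s).
Proof.
move=> [ub lub]; split=> [_ [p Cp <-]|b ble]; first exact/genpoly_eval_le/ub.
(* The maximal monomials of [U] form an upper bound of [C], so every monomial absorbed by [s] is
   already absorbed by some member of [C]. *)
pose U := [set m | exists2 p : genpoly X, C p & absorbed p m].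
have sU : natle s (GenPoly (@maximal_antichain X U)).
  apply: lub => p Cp; apply/genpoly_natle => m pm /=.
  rewrite absorbed_maximal; exists m; last exact: absorbs_refl.
  by exists p.
apply/genpoly_eval_lub => m sm; move/genpoly_natle/(_ m sm): sU => /=.
rewrite absorbed_maximal => -[a [p Cp pa] am].
apply: (@natle_trans _ (genpoly_eval p)); last by apply: ble; exists p.
by apply: mon_eval_le_genpoly; apply: absorbedW am.
Qed.

Definition mon_trunc (N : nat) m : monomial X := fun x => exp_trunc N (m x).

(** Truncated powers decrease to the full ones, and such limits pass through finite products and
    sums by continuity. *)
Lemma genpoly_eval_decreasing_to p :
  decreasing_to (fun N => \sum_(m <- support p) mon_eval (mon_trunc N m))
    (genpoly_eval p).
Proof.
rewrite /genpoly_eval; elim: (support p) => [|m s IHs].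
  rewrite big_nil; under eq_fun do rewrite big_nil.
  exact: decreasing_to_cst.
rewrite big_cons; under eq_fun do rewrite big_cons.
apply: decreasing_to_add => //; rewrite /mon_eval /index_enum.
elim: (Finite.enum X) => [|x xs IHxs].
  rewrite big_nil; under eq_fun do rewrite big_nil.
  exact: decreasing_to_cst.
rewrite big_cons; under eq_fun do rewrite big_cons.
by apply: decreasing_to_mul => //; apply: exp_pow_decreasing_to.
Qed.

(* Raising to infinity all exponents that are at least [M] leaves only finitely
   many monomials. *)
Definition mon_cap (M : nat) m : monomial X :=
  fun x => if m x is Some k then if (k < M)%N then Some k else None else None.

Lemma absorbs_cap M m : absorbs m (mon_cap M m).
Proof.
move=> x; rewrite /mon_cap; case: (m x) => [k|//].
by case: ifP => //= _; apply: leqnn.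
Qed.

Lemma mon_cap_finite M : exists s : seq (monomial X),
  forall m, mon_cap M m \in s.
Proof.
(* A capped monomial is a function into the finite type of exponents below [M] together with
   infinity. *)
pose decode (t : {ffun X -> option 'I_M}) : monomial X :=
  fun x => omap val (t x).
exists (map decode (enum {ffun X -> option 'I_M})) => m.
pose t := [ffun x => if m x is Some k then insub k else None] :
  {ffun X -> option 'I_M}.
have -> : mon_cap M m = decode t.
  apply/funext => x; rewrite /mon_cap /decode ffunE.
  by case: (m x) => [k|//]; case: insubP => [i -> <-|/negPf->].
by apply: map_f; rewrite mem_enum.
Qed.

Lemma chain_inf_cap (C : set (genpoly X)) i M : chain C -> C !=set0 ->
  is_inf C i ->
  exists2 p, C p & forall m, absorbed p m -> absorbed i (mon_cap M m).
Proof.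
move=> chC C0 [_ glb]; have [s sP] := mon_cap_finite M.
(* If all members of [C] absorbed [c], then [poly_mon c] would be a lower bound and hence below [i].
   So each [c] not absorbed by [i] has a witness in [C]; finitely many capped [c] matter, and the
   chain has a member below all their witnesses. *)
have /choice[q qP] c : exists q, C q /\ (absorbed q c -> absorbed i c).
  have [ic|nic] := pselect (absorbed i c).
    by have [p Cp] := C0; exists p.
  suff [q Cq nqc] : exists2 q, C q & ~ absorbed q c by exists q.
  apply: contrapT => noq; apply/nic/poly_mon_le/glb => q Cq.
  by apply/poly_mon_le; apply: contrapT => nqc; apply: noq; exists q.
have [p Cp ple] := natle_chain_min s chC C0 (fun c => (qP c).1).
exists p => // m pm; apply: (qP _).2.
have /genpoly_natle := ple _ (sP m); apply.
exact/(absorbedW pm)/absorbs_cap.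
Qed.

(* It suffices to bound a lower bound of the values by the value of [i] with
   every infinite exponent replaced by [N], for each [N].  With [M] above [N]
   and above the finite exponents of [i], a monomial of which the [M]-cap is
   absorbed by a monomial of [i] is itself absorbed by the [N]-truncation of
   that monomial. *)
Lemma genpoly_eval_inf (C : set (genpoly X)) i : chain C -> C !=set0 ->
  is_inf C i -> is_inf (genpoly_eval @` C) (genpoly_eval i).
Proof.
move=> chC C0 infi; split=> [_ [p Cp <-]|b ble].
  exact/genpoly_eval_le/infi.1.
have [_ [_ glb]] := genpoly_eval_decreasing_to i.
apply: glb => _ [N _ <-].
have /choice[M0 M0P] := @bounded_exponents X (support i).
pose M := (N + \sum_x M0 x)%N.
have M_ge m x k : m \in support i -> m x = Some k -> (k <= M)%N.
  move=> im mx; apply: leq_trans (M0P x m k im mx) _.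
  by rewrite /M (bigD1 x) //= addnCA leq_addr.
have [p Cp capP] := chain_inf_cap M chC C0 infi.
apply: (@natle_trans _ (genpoly_eval p)); first by apply: ble; exists p.
apply/genpoly_eval_lub => m /capP[a /supportP ia acap].
apply: (@natle_trans _ (mon_eval (mon_trunc N a))); last first.
  by move: a ia {acap}; apply/absorptive_sum_lub => //; apply: natle_refl.
apply: mon_eval_le => x; rewrite /mon_trunc /=.
(* Let [k] be the exponent of [x] in [m]. If [k < M], the cap keeps it and [a x] is finite and at
   most [k]. If [M <= k], the truncated exponent is at most [M]: it is [N], or a finite exponent of
   [i]. *)
move: (acap x) (M_ge a x); rewrite /mon_cap.
case: (m x) => [k|//]; case: (a x) => [j|] /=; last first.
  by case: ltnP => // Mk _ _; apply: leq_trans Mk; apply: leq_addr.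
case: ltnP => // Mk _ /(_ j ia erefl) jM; exact: leq_trans Mk.
Qed.

Lemma genpoly_eval_fully_continuous : fully_continuous genpoly_eval.
Proof.
move=> C chC C0; split=> e; first exact: genpoly_eval_sup.
exact: genpoly_eval_inf.
Qed.

Lemma genpoly_eval_unique (g : {rmorphism genpoly X -> K}) :
  (forall x, g (poly_var x) = h x) -> fully_continuous g -> g =1 genpoly_eval.
Proof.
move=> gh g_cont p; rewrite [in LHS](poly_sum_mon p) raddf_sum.
apply: eq_bigr => m _; rewrite poly_mon_prod /= rmorph_prod.
apply: eq_bigr => x _; case: (m x) => [n|].
  by rewrite -poly_varX rmorphXn gh.
(* For an infinite exponent, continuity of [g] makes its value an infimum of the powers of [h x], as
   [exp_pow] is. *)
apply: (is_inf_unique K_ordered _ (exp_decreasing_to _ _ (h x)).2) => //.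
have chX : chain (range (fun n => poly_var x ^+ n)).
  move=> _ _ [n1 _ <-] [n2 _ <-]; have le := natle_exp (@genpoly_absorptive X).
  by case/orP: (leq_total n1 n2) => /le; [right|left].
have X0 : range (fun n => poly_var x ^+ n) !=set0 by exists 1; exists 0%N.
have := (g_cont _ chX X0).2 _ (poly_var_inf x).
congr is_inf; rewrite image_comp; congr image; apply/funext => n /=.
by rewrite rmorphXn gh.
Qed.

End Evaluation.

Theorem theorem24 (X : finType) (K : comPzSemiRingType)
    (K_ordered : naturally_ordered K) (K_absorptive : absorptive K)
    (K_continuous : fully_continuous_semiring K) (h : X -> K) :
  exists f : {rmorphism genpoly X -> K},
    [/\ forall x : X, f (poly_var x) = h x,
        fully_continuous f
      & forall g : {rmorphism genpoly X -> K},
          (forall x : X, g (poly_var x) = h x) -> fully_continuous g -> g =1 f].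
Proof.
pose fD := GRing.isNmodMorphism.Build (genpoly X) K (genpoly_eval h)
  (genpoly_eval0 K_ordered K_absorptive K_continuous h,
   genpoly_evalD K_ordered K_absorptive K_continuous h).
pose fM := GRing.isMonoidMorphism.Build (genpoly X) K (genpoly_eval h)
  (genpoly_eval1 K_ordered K_absorptive K_continuous h,
   genpoly_evalM K_ordered K_absorptive K_continuous h).
pose f : {rmorphism genpoly X -> K} := HB.pack (genpoly_eval h) fD fM.
exists f; split.
- exact: genpoly_eval_var.
- exact: genpoly_eval_fully_continuous.
- exact: genpoly_eval_unique.
Qed.
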